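(* Let $r \ge 2$ and $s_r \ge \cdots \ge s_1 \ge 2$ be integers, let $s := s_1+\cdots+s_r$, and let $\mathbb{B}$ be an $r$-partite $r$-graph with part sizes $s_1,\ldots,s_r$. Then there is $n_0$ such that for every $n \ge n_0$, $$\mathrm{ex}(n,(t+1)\mathbb{B}) \le \binom{n}{r} - \binom{n-s_1(t+1)+1}{r} + \mathrm{ex}\left(n-s_1(t+1)+1,\mathbb{B}\right)$$ holds for all integers $t$ satisfying $$320 e s_1 s\left(\frac{\mathrm{ex}(n,\mathbb{B})}{\binom{n-1}{r-1}} + 320 e s_1 s^2 r!\right) \le t \le \frac{n}{512 e s_1 s^3 r!}.$$
   Context: An $r$-graph is a set of $r$-element subsets (edges) of a finite vertex set. An $r$-partite $r$-graph with part sizes $s_1,\ldots,s_r$ is an $r$-graph whose vertex set is partitioned into sets $W_1,\ldots,W_r$ with $|W_i|=s_i$ such that every edge contains exactly one vertex from each $W_i$. $\mathrm{ex}(n,F)$ denotes the maximum number of edges in an $n$-vertex $r$-graph containing no copy of $F$, and $\mathrm{ex}(n,(t+1)F)$ the maximum number of edges in an $n$-vertex $r$-graph not containing $t+1$ pairwise vertex-disjoint copies of $F$. $e$ is Euler's number. *)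

(* Defs.v *)
From mathcomp Require Import all_boot.
From Stdlib Require Import Reals.

Set Implicit Arguments.
Unset Strict Implicit.
Unset Printing Implicit Defensive.

Definition is_rgraph (T : finType) (r : nat) (H : {set {set T}}) : bool :=
  [forall e in H, #|e| == r].

Definition embeds (V T : finType) (F : {set {set V}}) (H : {set {set T}})
  (f : {ffun V -> T}) : bool :=
  injectiveb f && [forall e in F, (f @: e) \in H].

Definition contains_copies (V T : finType) (F : {set {set V}})
  (H : {set {set T}}) (k : nat) : bool :=
  [exists f : {ffun 'I_k -> {ffun V -> T}},
     [forall i, embeds F H (f i)] &&
     [forall i, forall j, (i != j) ==>
        [disjoint (f i) @: [set: V] & (f j) @: [set: V]]]].

Definition ex_copies (V : finType) (r n k : nat) (F : {set {set V}}) : nat :=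
  \max_(H : {set {set 'I_n}} | is_rgraph r H && ~~ contains_copies F H k) #|H|.

Definition ex (V : finType) (r n : nat) (F : {set {set V}}) : nat :=
  ex_copies r n 1 F.

Definition r_partite (V : finType) (r : nat) (sz : nat -> nat)
  (W : 'I_r -> {set V}) (B : {set {set V}}) : Prop :=
  (forall i, #|W i| = sz i) /\
  (forall i j, i != j -> [disjoint W i & W j]) /\
  (forall v : V, exists i, v \in W i) /\
  (forall e, e \in B -> forall i, #|e :&: W i| = 1%N).

(* Main.v *)
(* Put D = C(n-1, r-1) and l0 = s1(t+1) - 1, let L be the set of vertices of
   degree at least D/(16 s), and suppose that H has no t+1 disjoint copies of B
   but more edges than claimed.  If the links of a bounded set Y of vertices
   contain an (r-1)-set on average more than s1 - 1 times, then by pigeonhole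
   some s1-subset of Y has a dense common link, which contains a complete
   (r-1)-partite graph (Erdos), hence a copy of B meets Y in at most s1 vertices
   and otherwise avoids any prescribed set that is not too large.

   Let t' be the largest number of disjoint copies of B avoiding L.  Removing
   such s1-sets greedily from L gives |L| + s1 t' <= l0 + O(s1 s).  Counting
   edges, and using the lower bound on t, all but w vertices of L have nearly
   full degree, with w + t' <= t/4.  So L can be cut into s1-sets with at most
   one exceptional vertex each; all of these extend to copies, which sharpens
   the bound to |L| + s1 t' <= l0.  Finally delete, besides L, a set X outside
   L that covers t' disjoint copies, with |X| >= m := l0 - |L| >= s1 t' and
   |X| <= s m: the rest is B-free on at most n - l0 vertices, and the at most
   m D/16 edges lost on X are fewer than the gain
   C(n-|L|, r) - C(n-l0, r) >= m D/2.  This contradicts the choice of H. *)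
Require Import Defs.
From mathcomp Require Import all_boot zify.
From Stdlib Require Import Classical Reals Lra.
(* [Reals] rebinds [^] on [nat] to [Nat.pow]; this restores [expn]. *)
From mathcomp Require Import ssrnat.

Set Implicit Arguments.
Unset Strict Implicit.
Unset Printing Implicit Defensive.

(** * Degrees and popular subsets *)

Definition degree (T : finType) (H : {set {set T}}) (x : T) : nat :=
  #|[set e in H | x \in e]|.

Definition link (T : finType) (H : {set {set T}}) (Z : {set T}) (x : T) :=
  [set e : {set T} | [disjoint e & Z] && (x |: e \in H)].

Definition common_link (T : finType) (H : {set {set T}}) (Z Q : {set T}) :=
  [set e : {set T} | [forall x in Q, e \in link H Z x]].

Lemma card_supersets (T : finType) (r : nat) (P : {set T}) :
  #|[set e : {set T} | (#|e| == r) && (P \subset e)]|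
    <= 'C(#|T| - #|P|, r - #|P|).
Proof.
set E := [set e | _].
have inj : {in E &, injective (fun e => e :\: P)}.
  move=> e f; rewrite !inE => /andP[_ Pe] /andP[_ Pf] /= ef.
  by rewrite -(setID e P) -(setID f P) ef !(setIidPr _).
have <- : #|~: P| = #|T| - #|P| by rewrite cardsCs setCK.
rewrite -(card_in_imset inj) -cards_draws.
apply: subset_leq_card; apply/subsetP=> _ /imsetP[e + ->].
rewrite !inE => /andP[/eqP er Pe].
by rewrite -er cardsD (setIidPr Pe) eqxx andbT setDE subsetIr.
Qed.

Lemma card_bigcup_le (I T : finType) (P : pred I) (F : I -> {set T}) :
  #|\bigcup_(i | P i) F i| <= \sum_(i | P i) #|F i|.
Proof.
elim/big_ind2: _ => [|m A n B hA hB|] //; first by rewrite cards0.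
by apply: leq_trans (leq_add hA hB); rewrite cardsU leq_subr.
Qed.

Lemma degree_le (T : finType) (r : nat) (H : {set {set T}}) (x : T) :
  is_rgraph r H -> degree H x <= 'C(#|T|.-1, r.-1).
Proof.
move=> /forall_inP rH; rewrite -!subn1 -(cards1 x).
apply: leq_trans (card_supersets _ _); apply: subset_leq_card.
apply/subsetP=> e; rewrite !inE => /andP[eH xe].
by rewrite rH // sub1set.
Qed.

Lemma card_meeting_le (T : finType) (H : {set {set T}}) (X : {set T}) :
  #|[set e in H | ~~ [disjoint e & X]]| <= \sum_(x in X) degree H x.
Proof.
rewrite -sum1_card.
have -> : \sum_(x in X) degree H x =
  \sum_(e in H) \sum_(x in X | x \in e) 1.
  under eq_bigr do rewrite /degree -sum1_card.
  rewrite (exchange_big_dep (fun e => e \in H)) /=; last first.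
    by move=> x e _; rewrite inE => /andP[].
  apply: eq_bigr => e eH; apply: eq_bigl => x; by rewrite inE eH.
rewrite [X in X <= _](eq_bigl (fun e => (e \in H) && ~~ [disjoint e & X]));
  last by move=> e; rewrite inE.
rewrite big_mkcondr; apply: leq_sum => e eH.
case: ifP => // /pred0Pn[x /andP[xe xX]].
by rewrite (bigD1 x) //; apply/andP.
Qed.

Lemma sum_degree (T : finType) (r : nat) (H : {set {set T}}) :
  is_rgraph r H -> \sum_x degree H x = r * #|H|.
Proof.
move=> /forall_inP rH; under eq_bigr do rewrite /degree -sum1_card.
rewrite (exchange_big_dep (fun e => e \in H)) /=; last first.
  by move=> x e _; rewrite inE => /andP[].
rewrite mulnC -sum_nat_const; apply: eq_bigr => e eH.
rewrite -(eqP (rH e eH)) -sum1_card; apply: eq_bigl => x; by rewrite inE eH.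
Qed.

(** The average multiplicity is at least [a + 1/q], so at least [N / (q * #|Y|)] points lie in more
    than [a] of the sets [G x]. Each such point selects an [a.+1]-subset of [Y]; there are at most
    [2 ^ #|Y|] of these, so one is selected by many points. *)
Lemma popular_subset (I S : finType) (Y : {set I}) (G : I -> {set S})
  (N a q : nat) :
  0 < N -> #|\bigcup_(x in Y) G x| <= N ->
  (q * a + 1) * N <= q * \sum_(x in Y) #|G x| ->
  exists Q : {set I}, [/\ Q \subset Y, #|Q| = a.+1 &
    N <= q * #|Y| * 2 ^ #|Y| * #|[set y | [forall x in Q, y \in G x]]|].
Proof.
move=> N0; set R := \bigcup_(x in Y) G x => RN hsum.
pose nb y := [set x in Y | y \in G x].
pose P := [set y in R | a < #|nb y|].
have sumE : \sum_(x in Y) #|G x| = \sum_(y in R) #|nb y|.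
  under eq_bigr do rewrite -sum1_card.
  rewrite (exchange_big_dep (fun y => y \in R)) /=; last first.
    by move=> x y xY yG; apply/bigcupP; exists x.
  apply: eq_bigr => y _; rewrite sum1_card; apply: eq_card => x.
  by rewrite !inE unfold_in /=.
have sumle : \sum_(x in Y) #|G x| <= a * N + #|Y| * #|P|.
  rewrite sumE; apply: (@leq_trans (\sum_(y in R) (a + #|Y| * (y \in P)))).
    apply: leq_sum => y yR; rewrite inE yR /=.
    case: (ltnP a) => [_|h]; last by rewrite muln0 addn0.
    rewrite muln1; apply: leq_trans (leq_addl _ _).
    by apply: subset_leq_card; apply/subsetP=> x; rewrite inE => /andP[].
  rewrite big_split /= sum_nat_const mulnC -big_distrr /= leq_add ?leq_mul //.
  rewrite -big_mkcondr /= sum1_card; apply: subset_leq_card.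
  by apply/subsetP=> y; rewrite unfold_in /= => /andP[].
have NP : N <= q * #|Y| * #|P| by nia.
have P0 : 0 < #|P| by case: #|P| NP => //; nia.
pose C (Q : {set I}) := [set y | [forall x in Q, y \in G x]].
pose QQ := [set Q : {set I} | Q \subset Y & #|Q| == a.+1].
have PC : P \subset \bigcup_(Q in QQ) C Q.
  apply/subsetP=> y; rewrite inE => /andP[_ ay].
  have /set0Pn[Q] : [set Q : {set I} | Q \subset nb y & #|Q| == a.+1] != set0.
    by rewrite -card_gt0 cards_draws bin_gt0.
  rewrite inE => /andP[Qn Qa]; apply/bigcupP; exists Q.
    rewrite inE Qa andbT; apply: subset_trans Qn _.
    by apply/subsetP=> x; rewrite inE => /andP[].
  rewrite inE; apply/forall_inP=> x xQ.
  by move/subsetP: Qn => /(_ x xQ); rewrite inE => /andP[].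
have QQle : #|QQ| <= 2 ^ #|Y|.
  rewrite -card_powerset; apply: subset_leq_card; apply/subsetP=> Q.
  by rewrite !inE => /andP[].
have [/existsP[Q /andP[]]|] :=
  boolP [exists Q, (Q \in QQ) && (#|P| <= 2 ^ #|Y| * #|C Q|)].
  rewrite inE => /andP[QY /eqP Qa] hP; exists Q; split=> //.
  by apply: leq_trans NP _; rewrite -[X in _ <= X]mulnA leq_mul2l hP orbT.
rewrite negb_exists => /forallP hno; exfalso.
have h1 : #|P| <= \sum_(Q in QQ) #|C Q|.
  apply: leq_trans (subset_leq_card PC) _; exact: card_bigcup_le.
have h2 : \sum_(Q in QQ) (2 ^ #|Y| * #|C Q|) <= \sum_(Q in QQ) #|P|.-1.
  apply: leq_sum => Q QQQ; have := hno Q; rewrite QQQ /=; lia.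
move: h2; rewrite -big_distrr sum_nat_const /= => h2.
have : 2 ^ #|Y| * #|P| <= 2 ^ #|Y| * #|P|.-1.
  apply: leq_trans (leq_trans h2 _); first by rewrite leq_mul2l h1 orbT.
  by rewrite leq_mul2r QQle orbT.
by rewrite leq_pmul2l ?expn_gt0 //; lia.
Qed.

(** * Complete partite subgraphs *)

Lemma card_link (T : finType) (k : nat) (H : {set {set T}}) (Z e : {set T})
  (x : T) :
  is_rgraph k.+1 H -> x \in Z -> e \in link H Z x -> x \notin e /\ #|e| = k.
Proof.
move=> /forall_inP rH xZ; rewrite inE => /andP[eZ xeH].
have xe : x \notin e.
  by apply/negP=> xe; move/pred0P: eZ => /(_ x) /=; rewrite xe xZ.
by split=> //; move: (rH _ xeH); rewrite cardsU1 xe eqSS => /eqP.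
Qed.

(** With [n = #|T|]: an edge through [x] lost in the link contains a pair [[set x; z]] with [z] in
    [Z], so at most [#|Z| * 'C(n - 2, k - 1)] edges are lost. The identity [(n - 1) * 'C(n - 2, k -
    1) = k * 'C(n - 1, k)] turns this into a fraction [1/K] of ['C(n - 1, k)]. *)
Lemma degree_le_link (T : finType) (k K : nat) (H : {set {set T}})
  (Z : {set T}) (x : T) :
  is_rgraph k.+1 H -> x \in Z -> K * k * #|Z| <= #|T|.-1 ->
  K * degree H x <= K * #|link H Z x| + 'C(#|T|.-1, k).
Proof.
move=> rH xZ KZ; have /forall_inP rH' := rH.
pose B z := [set e : {set T} | (#|e| == k.+1) && ([set x; z] \subset e)].
have degle : degree H x <= #|link H Z x| + \sum_(z in Z :\ x) #|B z|.
  pose E := [set x |: e | e in link H Z x] :|: \bigcup_(z in Z :\ x) B z.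
  apply: (@leq_trans #|E|).
    apply: subset_leq_card; apply/subsetP=> e; rewrite inE => /andP[eH xe].
    rewrite inE; have [dis|] := boolP [disjoint e :\ x & Z].
      apply/orP; left; apply/imsetP; exists (e :\ x); last by rewrite setD1K.
      by rewrite inE dis setD1K.
    case/pred0Pn => z /andP[]; rewrite /= in_setD1 => /andP[zx ze] zZ.
    apply/orP; right; apply/bigcupP; exists z; first by rewrite !inE zx.
    by rewrite inE rH' // subUset !sub1set xe.
  rewrite cardsU; apply: leq_trans (leq_subr _ _) _.
  by apply: leq_add; [exact: leq_imset_card | exact: card_bigcup_le].
have ZxZ : #|Z :\ x| <= #|Z| by rewrite subset_leq_card // subD1set.
(* The factor [k] voids the first bound at [k = 0], where [k.-1] is truncated; there the second
   clause takes over, as a pair does not fit into a 1-set. *)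
have Ble z : z \in Z :\ x -> k * #|B z| <= k * 'C(#|T|.-1.-1, k.-1) /\
    (k = 0 -> #|B z| = 0).
  rewrite in_setD1 eq_sym => /andP[zx _]; split.
    case: k @B {rH rH' KZ degle} => [|j] B //; rewrite leq_mul2l orFb.
    have := card_supersets j.+2 [set x; z]; rewrite cards2 zx.
    by rewrite !subSS subn0 !subnS subn0.
  move=> k0; apply/eqP; rewrite cards_eq0 -subset0; apply/subsetP=> e.
  rewrite inE k0 => /andP[/eqP e1 /subset_leq_card].
  by rewrite cards2 zx e1.
suff : K * \sum_(z in Z :\ x) #|B z| <= 'C(#|T|.-1, k) by move=> *; nia.
case: k @B rH rH' KZ degle Ble => [|j] B rH rH' KZ degle Ble.
  by rewrite big1 ?muln0 // => z /Ble[_ ->].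
have : j.+1 * \sum_(z in Z :\ x) #|B z| <= #|Z| * (j.+1 * 'C(#|T|.-1.-1, j)).
  rewrite big_distrr /=.
  apply: (@leq_trans (\sum_(z in Z :\ x) j.+1 * 'C(#|T|.-1.-1, j))).
    by apply: leq_sum => z /Ble[].
  by rewrite sum_nat_const leq_mul2r ZxZ orbT.
have := mul_bin_diag #|T|.-1 j; move: KZ.
move: #|T|.-1 'C(_, j.+1) 'C(_, j) (\sum_(z in _) _) => n c d S KZ e1 e2.
rewrite -(leq_pmul2l (ltn0Sn j)) -e1; nia.
Qed.

Lemma common_link_rgraph (T : finType) (k : nat) (H : {set {set T}})
  (Z Q : {set T}) :
  is_rgraph k.+1 H -> Q \subset Z -> Q != set0 ->
  is_rgraph k (common_link H Z Q).
Proof.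
move=> rH /subsetP QZ /set0Pn[x xQ]; apply/forall_inP=> e.
rewrite inE => /forall_inP/(_ x xQ) ex.
by have [_ ->] := card_link rH (QZ x xQ) ex.
Qed.

(** Links avoid [Z], hence any fixed [y] in [Y]; so all of them consist of [k]-subsets of the other
    [#|T|.-1] vertices, and [popular_subset] applies. *)
Lemma exists_dense_common_link (T : finType) (k a q : nat)
  (H : {set {set T}}) (Y Z : {set T}) :
  is_rgraph k.+1 H -> Y \subset Z -> 0 < 'C(#|T|.-1, k) ->
  (q * a + 1) * 'C(#|T|.-1, k) <= q * \sum_(x in Y) #|link H Z x| ->
  exists Q : {set T}, [/\ Q \subset Y, #|Q| = a.+1 &
    'C(#|T|.-1, k) <= q * #|Y| * 2 ^ #|Y| * #|common_link H Z Q|].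
Proof.
move=> rH YZ N0 hsum; apply: popular_subset => //.
have /set0Pn[y yY] : Y != set0.
  by apply: contraTneq hsum => ->; rewrite big_set0 muln0 -ltnNge; nia.
have -> : #|T|.-1 = #|~: [set y]| by rewrite cardsC1.
rewrite -cards_draws; apply: subset_leq_card; apply/subsetP=> e.
case/bigcupP => x xY ex; have /subsetP YZ' := YZ.
have [_ ek] := card_link rH (YZ' x xY) ex.
rewrite inE ek eqxx andbT subsetC sub1set inE.
move: ex; rewrite inE => /andP[dis _]; apply/negP=> ye.
by move/pred0P: dis => /(_ y) /=; rewrite ye YZ'.
Qed.

Lemma bin_le_double (n k : nat) : 0 < n -> 2 * k <= n ->
  'C(n, k) <= 2 * 'C(n.-1, k).
Proof.
move=> n0 kn; have := mul_bin_down n k; rewrite -(leq_pmul2l n0); nia.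
Qed.

(** Erdos's theorem, by induction on the uniformity: among many vertices of large degree some [m]
    have a dense common link, and these form the first part. Disjointness of the parts is not
    stated; it follows from uniformity when it is needed. *)
Lemma exists_complete_partite (k m q : nat) : 0 < m ->
  exists n0, forall (T : finType) (G : {set {set T}}), n0 <= #|T| ->
    is_rgraph k G -> 'C(#|T|, k) <= q * #|G| ->
    exists A : nat -> {set T}, (forall i, i < k -> #|A i| = m) /\
      forall h : nat -> T, (forall i, i < k -> h i \in A i) ->
        [set h (val i) | i : 'I_k] \in G.
Proof.
move=> m0; elim: k q => [|k IHk] q.
  exists 0 => T G _ /forall_inP rG hG; exists (fun=> set0); split=> // h _.
  have /set0Pn[e eG] : G != set0.
    by apply: contraTneq hG => ->; rewrite cards0 muln0 bin0.
  have /eqP := rG e eG; move/eqP; rewrite cards_eq0 => /eqP e0.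
  suff -> : [set h (val i) | i : 'I_0] = e by [].
  rewrite e0; apply/setP=> x; rewrite inE; apply/imsetP=> -[[]] //.
(* [M] vertices of degree at least [D / (2 * q)], each keeping at least [D / (4 * q)] in its link,
   have link sizes adding up to [m * D]. *)
have [M defM] : exists M, M = 4 * q * m by exists (4 * q * m).
have [n1 Hn1] := IHk (2 * (M * 2 ^ M)).
exists (n1 + 4 * q * k * M + 2 * k + 2 * q * M + 2) => T G nT rG hG.
have [nT1 nT2 nT3 nT4] : [/\ n1 <= #|T|, 4 * q * k * M <= #|T|.-1,
  2 * k < #|T| & 2 * q * M <= #|T|] by split; lia.
set D := 'C(#|T|.-1, k).
have D0 : 0 < D by rewrite bin_gt0; lia.
pose W := [set x | D <= 2 * q * degree G x].
(* The degrees add up to at least [#|T| * D / q]. Vertices outside [W] contribute at most half of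
   this, and each vertex of [W] at most [D]. *)
have cW : M <= #|W|.
  have := sum_degree rG; rewrite (bigID (mem W)) /= => sd.
  have s1 : \sum_(x in W) degree G x <= #|W| * D.
    rewrite -sum_nat_const; apply: leq_sum => x _.
    exact: (degree_le x rG).
  have s2 : 2 * q * (\sum_(x | x \notin W) degree G x) <= #|T| * D.
    rewrite big_distrr -sum_nat_const big_mkcond /=; apply: leq_sum => x _.
    by case: ifP => //; rewrite inE -ltnNge => /ltnW.
  have := mul_bin_diag #|T| k; rewrite -/D => e1.
  have s3 : #|T| * D <= q * (k.+1 * #|G|).
    by rewrite e1 mulnCA leq_mul2l hG.
  have : #|T| * D <= 2 * q * (#|W| * D).
    have s4 : 2 * q * (\sum_(x in W) degree G x) <= 2 * q * (#|W| * D).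
      by rewrite leq_mul2l s1 orbT.
    rewrite -sd mulnDr in s3; lia.
  rewrite mulnA leq_pmul2r // => h.
  case: (posnP q) => [q0|q0]; first by rewrite defM q0.
  by rewrite -(leq_pmul2l (_ : 0 < 2 * q)); lia.
have /card_geqP[ys [uys sys yW]] := cW.
pose Y := [set x in ys].
have cY : #|Y| = M by rewrite cardsE; move/card_uniqP: uys => ->.
have lk x : x \in Y -> D <= 4 * q * #|link G Y x|.
  move=> xY; have := @degree_le_link _ k (4 * q) _ Y x rG xY.
  rewrite cY -/D => /(_ ltac:(lia)).
  have : x \in W by apply: yW; move: xY; rewrite inE.
  rewrite inE; lia.
have sl : (1 * m.-1 + 1) * D <= 1 * \sum_(x in Y) #|link G Y x|.
  case: (posnP q) => [q0|q0].
    by move: hG; rewrite q0 mul0n leqNgt bin_gt0; lia.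
  have : M * D <= 4 * q * \sum_(x in Y) #|link G Y x|.
    by rewrite -cY -sum_nat_const big_distrr; apply: leq_sum.
  by rewrite defM !mul1n addn1 prednK // -mulnA leq_pmul2l // muln_gt0.
have [Q [QY cQ hQ]] := exists_dense_common_link rG (subxx Y) D0 sl.
have Q0 : Q != set0 by rewrite -card_gt0 cQ.
have [||A [cA hA]] := Hn1 _ (common_link G Y Q) _ (common_link_rgraph rG QY Q0).
- by lia.
- have := @bin_le_double #|T| k; rewrite -/D cY mul1n in hQ *.
  move=> /(_ ltac:(lia) ltac:(lia)) h; apply: leq_trans h _.
  by rewrite -mulnA leq_mul2l hQ.
exists (fun i => if i is j.+1 then A j else Q); split.
  by case=> [_|i /cA //]; rewrite cQ prednK.
move=> h hh; have := hA (fun i => h i.+1) (fun i ik => hh i.+1 ik).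
rewrite inE => /forall_inP/(_ _ (hh 0 isT)); rewrite inE => /andP[_].
congr (_ \in G); apply/setP=> x; rewrite !inE; apply/orP/imsetP.
  case=> [/eqP->|/imsetP[i _ ->]]; first by exists ord0.
  by exists (lift ord0 i).
case=> i _ ->; case: (unliftP ord0 i) => [j|] ->; last by left.
by right; apply/imsetP; exists j.
Qed.

(** * Disjoint copies *)

(** Each [W i] is sent injectively into [A i]. An edge of [B] has one vertex in each [W i], so its
    image is a transversal of the boxes. *)
Lemma embeds_in_boxes (T V : finType) (r : nat) (sz : nat -> nat)
  (W : 'I_r -> {set V}) (B : {set {set V}}) (H : {set {set T}})
  (A : nat -> {set T}) :
  0 < r -> r_partite sz W B -> is_rgraph r H ->
  (forall i, i < r -> 0 < sz i <= #|A i|) ->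
  (forall h : nat -> T, (forall i, i < r -> h i \in A i) ->
     [set h (val i) | i : 'I_r] \in H) ->
  exists f : {ffun V -> T}, embeds B H f /\
    forall v (i : 'I_r), v \in W i -> f v \in A i.
Proof.
move=> r0 [cW [dW [covW edgeB]]] /forall_inP rH szA transv.
have [p pA] : exists p : 'I_r -> T, forall i, p i \in A i.
  apply: (@fin_all_exists _ _ (fun i x => x \in A (val i))) => i; apply/set0Pn.
  by rewrite -card_gt0; case/andP: (szA i (ltn_ord i)) => /leq_trans; apply.
pose d := p (Ordinal r0).
have transv' (h : 'I_r -> T) :
    (forall i, h i \in A i) -> [set h i | i : 'I_r] \in H.
  move=> hA; pose h' l := if insub l is Some i then h i else d.
  have h'E (i : 'I_r) : h' (val i) = h i by rewrite /h' valK.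
  rewrite -(eq_imset _ h'E); apply: transv => i ir.
  by have := hA (Ordinal ir); rewrite -h'E.
(* A vertex common to two boxes could be chosen for both, and that transversal would have fewer than
   [r] vertices. *)
have disA (i j : 'I_r) x : x \in A i -> x \in A j -> i = j.
  move=> xi xj; pose h l := if (l == i) || (l == j) then x else p l.
  have hA l : h l \in A l.
    by rewrite /h; case: ifP => // /orP[] /eqP ->.
  have := rH _ (transv' h hA); rewrite -[X in _ == X]card_ord => /imset_injP.
  by apply; rewrite ?inE // /h !eqxx orbT.
have [cls clsW] : exists cls : V -> 'I_r, forall v, v \in W (cls v).
  by apply: (@fin_all_exists _ _ (fun v i => v \in W i)) => v.
have clsE v i : v \in W i -> cls v = i.
  move=> vi; apply/eqP; apply: contraT => /dW /pred0P/(_ v) /=.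
  by rewrite clsW vi.
pose f := [ffun v => nth d (enum (A (cls v))) (index v (enum (W (cls v))))].
have lt_idx v : index v (enum (W (cls v))) < size (enum (A (cls v))).
  rewrite -cardE; have := szA _ (ltn_ord (cls v)) => /andP[_].
  by apply: leq_trans; rewrite -cW cardE index_mem mem_enum.
have fA v : f v \in A (cls v) by rewrite ffunE -mem_enum mem_nth.
have injf : injective f.
  move=> v w fvw; have cvw : cls v = cls w.
    by apply: (disA _ _ (f v)); rewrite ?fA // fvw.
  move: fvw (lt_idx v) (lt_idx w); rewrite !ffunE cvw => /eqP + lv lw.
  rewrite nth_uniq ?enum_uniq // => /eqP ivw.
  have mem u : cls u = cls w -> u \in enum (W (cls w)).
    by move=> <-; rewrite mem_enum.
  by rewrite -(nth_index v (mem v cvw)) ivw nth_index // mem.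
exists f; split; last by move=> v i /clsE <-.
apply/andP; split; first exact/injectiveP.
apply/forall_inP=> e eB.
have [u ue] : exists u : 'I_r -> V, forall i, e :&: W i = [set u i].
  apply: (@fin_all_exists _ _ (fun i v => e :&: W i = [set v])) => i.
  by apply/cards1P; rewrite edgeB.
have uW i : (u i \in e) && (u i \in W i) by rewrite -in_setI ue set11.
suff -> : f @: e = [set f (u i) | i : 'I_r].
  apply: transv' => i; have := fA (u i).
  by case/andP: (uW i) => _ /clsE ->.
apply/setP=> x; apply/imsetP/imsetP => [[v ve ->]|[i _ ->]].
  exists (cls v) => //; congr (f _); apply/set1P.
  by rewrite -ue inE ve clsW.
by exists (u i) => //; case/andP: (uW i).
Qed.

(* [Y] is rich when the average [k]-set lies in more than [a] of the links of
   the vertices of [Y], even after each link loses a [1/K] fraction. *)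
Definition rich (T : finType) (k K a : nat) (H : {set {set T}})
  (Y : {set T}) : bool :=
  (K * a + 1 + #|Y|) * 'C(#|T|.-1, k) <= K * \sum_(x in Y) degree H x.

(** The loss from removing [Z] is already allowed for in [rich], so some [sz 0] vertices of [Y] have
    a dense common link. They serve as the first box; a complete [k]-partite subgraph of the common
    link supplies the others, which avoid [Z] because links do. *)
Lemma exists_copy_at_rich (V : finType) (k M K : nat) (sz : nat -> nat)
  (W : 'I_k.+1 -> {set V}) (B : {set {set V}}) :
  r_partite sz W B -> (forall i, i < k.+1 -> 0 < sz i) ->
  exists n0, forall (T : finType) (H : {set {set T}}) (Y Z : {set T}),
    n0 <= #|T| -> is_rgraph k.+1 H -> Y \subset Z -> #|Y| <= M ->
    K * k * #|Z| <= #|T|.-1 -> rich k K (sz 0).-1 H Y ->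
    exists (Q : {set T}) f, [/\ Q \subset Y, #|Q| = sz 0, embeds B H f &
      f @: [set: V] \subset Q :|: ~: Z].
Proof.
move=> partB sz0; pose m := \sum_(i < k.+1) sz i.
have szm i : i < k.+1 -> sz i <= m.
  by move=> ik; rewrite /m (bigD1 (Ordinal ik)) //= leq_addr.
have m0 : 0 < m by apply: leq_trans (szm 0 isT); apply: sz0.
have [n1 Hn1] := @exists_complete_partite k m (2 * (K * M * 2 ^ M)) m0.
exists (n1 + 2 * k + 2) => T H Y Z nT rH YZ YM KZ richY.
set D := 'C(#|T|.-1, k).
have D0 : 0 < D by rewrite bin_gt0; lia.
have YZ' := subsetP YZ.
have suml : (K * (sz 0).-1 + 1) * D <= K * \sum_(x in Y) #|link H Z x|.
  have : K * \sum_(x in Y) degree H x <=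
      K * \sum_(x in Y) #|link H Z x| + #|Y| * D.
    rewrite -sum_nat_const !big_distrr -big_split /=; apply: leq_sum => x xY.
    by apply: degree_le_link => //; apply: YZ'.
  by move: richY; rewrite /rich -/D mulnDl; lia.
have [Q [QY cQ hQ]] := exists_dense_common_link rH YZ D0 suml.
have Q0 : Q != set0 by rewrite -card_gt0 cQ.
have QZ := subset_trans QY YZ.
have cQ' : #|Q| = sz 0 by rewrite cQ prednK // sz0.
have [||A [cA hA]] := Hn1 _ (common_link H Z Q) _ (common_link_rgraph rH QZ Q0).
- by lia.
- have := @bin_le_double #|T| k; rewrite -/D.
  move=> /(_ ltac:(lia) ltac:(lia)) h; apply: leq_trans h _.
  rewrite -mulnA leq_mul2l /=; apply: leq_trans hQ _.
  by rewrite leq_mul // leq_mul ?leq_mul // leq_exp2l.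
pose A' i := if i is j.+1 then A j else Q.
have [||f [emb fA]] := @embeds_in_boxes T V k.+1 sz W B H A' isT partB rH.
- case=> [|i] ik; first by rewrite /= cQ' sz0 /=.
  by rewrite /= cA // szm // sz0.
- move=> h hh; have := hA (fun i => h i.+1) (fun i ik => hh i.+1 ik).
  rewrite inE => /forall_inP/(_ _ (hh 0 isT)); rewrite inE => /andP[_].
  congr (_ \in H); apply/setP=> x; rewrite !inE; apply/orP/imsetP.
    case=> [/eqP->|/imsetP[i _ ->]]; first by exists ord0.
    by exists (lift ord0 i).
  case=> i _ ->; case: (unliftP ord0 i) => [j|] ->; last by left.
  by right; apply/imsetP; exists j.
exists Q, f; split=> //; apply/subsetP=> _ /imsetP[v _ ->].
have [_ [_ [covW _]]] := partB; have [i vi] := covW v.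
have := fA v i vi; case: (unliftP ord0 i) => [j|] ->; rewrite inE => /= fvA.
  have [p pA] : exists p : 'I_k -> T, forall i, p i \in A i.
    apply: (@fin_all_exists _ _ (fun i x => x \in A (val i))) => l.
    apply/set0Pn; by rewrite -card_gt0 (cA _ (ltn_ord l)).
  (* A transversal through [f v]: as a member of the common link it is disjoint from [Z]. *)
  pose h (l : nat) :=
    if l == j then f v else if insub l is Some i then p i else f v.
  have /hA : forall i, i < k -> h i \in A i.
    move=> l lk; rewrite /h; case: eqP => [->//|_].
    by rewrite insubT; exact: (pA (Ordinal lk)).
  have /set0Pn[x xQ] := Q0.
  rewrite inE => /forall_inP/(_ x xQ); rewrite inE => /andP[/pred0P dis _].
  apply/orP; right; rewrite inE; apply/negP=> fZ.
  have := dis (f v); rewrite /= fZ andbT => /negP[].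
  by apply/imsetP; exists j => //; rewrite /h eqxx.
by rewrite fvA.
Qed.

Definition copies_in (V T : finType) (B : {set {set V}}) (H : {set {set T}})
  (k : nat) (U : {set T}) : Prop :=
  exists f : 'I_k -> {ffun V -> T},
    [/\ forall i, embeds B H (f i),
        forall i j, i != j ->
          [disjoint f i @: [set: V] & f j @: [set: V]] &
        forall i, f i @: [set: V] \subset U].

Lemma copies_inP (V T : finType) (B : {set {set V}}) (H : {set {set T}})
  (k : nat) : copies_in B H k [set: T] <-> contains_copies B H k.
Proof.
split=> [[f [fe fd _]]|/existsP[f /andP[/forallP fe /forallP fd]]].
  apply/existsP; exists [ffun i => f i]; apply/andP; split.
    by apply/forallP=> i; rewrite ffunE.
  apply/forallP=> i; apply/forallP=> j; apply/implyP.
  by rewrite !ffunE; apply: fd.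
exists f; split=> [//|i j|i]; last exact: subsetT.
by move/implyP: (forallP (fd i) j).
Qed.

Lemma copies_inW (V T : finType) (B : {set {set V}}) (H : {set {set T}})
  (k k' : nat) (U U' : {set T}) :
  k' <= k -> U \subset U' -> copies_in B H k U -> copies_in B H k' U'.
Proof.
move=> kk UU [f [fe fd fU]]; exists (f \o widen_ord kk).
split=> [i|i j ij|i] /=.
- exact: fe.
- by apply: fd; rewrite -val_eqE /= val_eqE.
- exact: subset_trans (fU _) UU.
Qed.

Lemma copies_in0 (V T : finType) (B : {set {set V}}) (H : {set {set T}})
  (U : {set T}) : copies_in B H 0 U.
Proof.
have f : 'I_0 -> {ffun V -> T} by case.
by exists f; split; case.
Qed.

Lemma copies_in1 (V T : finType) (B : {set {set V}}) (H : {set {set T}})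
  (f : {ffun V -> T}) (U : {set T}) :
  embeds B H f -> f @: [set: V] \subset U -> copies_in B H 1 U.
Proof.
by move=> fe fU; exists (fun=> f); split=> [//|i j|//]; rewrite !ord1 eqxx.
Qed.

Lemma copies_in_add (V T : finType) (B : {set {set V}}) (H : {set {set T}})
  (k k' : nat) (U U' : {set T}) :
  [disjoint U & U'] -> copies_in B H k U -> copies_in B H k' U' ->
  copies_in B H (k + k') (U :|: U').
Proof.
move=> UU' [f [fe fd fU]] [g [ge gd gU]].
pose h i := match fintype.split i with inl j => f j | inr j => g j end.
exists h; split=> [i|i j|i]; rewrite /h.
- by case: splitP.
- rewrite -(inj_eq (can_inj (@splitK k k'))).
  case: (fintype.split i) (fintype.split j) => [i'|i'] [j'|j'] ij.
  + by apply: fd; apply: contraNneq ij => ->.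
  + exact: disjointWl (fU _) (disjointWr (gU _) UU').
  + by rewrite disjoint_sym; apply: disjointWl (fU _) (disjointWr (gU _) UU').
  + by apply: gd; apply: contraNneq ij => ->.
- case: splitP => j _; first exact: subset_trans (fU j) (subsetUl _ _).
  exact: subset_trans (gU j) (subsetUr _ _).
Qed.

Lemma copies_in_support (V T : finType) (B : {set {set V}})
  (H : {set {set T}}) (k : nat) (U : {set T}) :
  copies_in B H k U ->
  exists U' : {set T},
    [/\ U' \subset U, #|U'| <= k * #|V| & copies_in B H k U'].
Proof.
move=> [f [fe fd fU]]; exists (\bigcup_i f i @: [set: V]); split.
- by apply/bigcupsP=> i _; apply: fU.
- apply: leq_trans (card_bigcup_le _ _) _.
  rewrite -[X in X * _]card_ord -sum_nat_const; apply: leq_sum => i _.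
  by apply: leq_trans (leq_imset_card _ _) _; rewrite cardsT.
- by exists f; split=> // i; exact: (bigcup_sup i).
Qed.

(** [P g L] is an invariant promising [g] further copies from [L]. Each copy removes its [sz 0]
    vertices from [L], and its whole image joins the forbidden set [Z]; since [g] drops by one,
    [#|Z| + #|L| + g * #|V|] does not grow. *)
Lemma greedy_copies (V : finType) (k M K : nat) (sz : nat -> nat)
  (W : 'I_k.+1 -> {set V}) (B : {set {set V}}) :
  r_partite sz W B -> (forall i, i < k.+1 -> 0 < sz i) ->
  exists n0, forall (T : finType) (H : {set {set T}})
    (P : nat -> {set T} -> Prop), n0 <= #|T| -> is_rgraph k.+1 H ->
    (forall g L, P g.+1 L -> exists Y : {set T},
       [/\ Y \subset L, #|Y| <= M, rich k K (sz 0).-1 H Y &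
         forall Q : {set T}, Q \subset Y -> #|Q| = sz 0 -> P g (L :\: Q)]) ->
    forall g (L Z : {set T}), P g L -> [disjoint L & Z] ->
      K * k * (#|Z| + #|L| + g * #|V|) <= #|T|.-1 -> copies_in B H g (~: Z).
Proof.
move=> partB sz0; have [n0 Hn0] := exists_copy_at_rich M K partB sz0.
exists n0 => T H P nT rH step; elim=> [|g IHg] L Z PL LZ KZ.
  exact: copies_in0.
have [Y [YL YM richY PQ]] := step g L PL.
have hZ : #|Z :|: L| <= #|Z| + #|L| by rewrite cardsU leq_subr.
have [||Q [f [QY cQ emb fQ]]] := Hn0 T H Y (Z :|: L) nT rH _ YM _ richY.
- exact: subset_trans YL (subsetUr _ _).
- apply: leq_trans KZ; rewrite leq_mul2l; apply/orP; right; lia.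
set F := f @: [set: V] in fQ.
have cF : #|F| <= #|V|.
  by apply: leq_trans (leq_imset_card _ _) _; rewrite cardsT.
have inF x : x \in F -> x \in Q \/ x \notin Z /\ x \notin L.
  move/(subsetP fQ); rewrite !inE negb_or => /orP[|/andP[]]; by [left | right].
have LZ' x : x \in L -> x \notin Z.
  by move=> xL; move/pred0P: LZ => /(_ x) /=; rewrite xL => /negbT.
have FZ x : x \in F -> x \notin Z.
  by case/inF=> [xQ|[]//]; apply: LZ'; apply: (subsetP YL); apply: (subsetP QY).
have cg : copies_in B H g (~: (Z :|: F)).
  apply: (IHg (L :\: Q)); first exact: PQ.
    apply/pred0P=> x /=; rewrite !inE; apply/negbTE/negP.
    move=> /andP[/andP[xQ xL] /orP[xZ|/inF[xQ'|[_]]]].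
    - by move: (LZ' x xL); rewrite xZ.
    - by move: xQ; rewrite xQ'.
    - by rewrite xL.
  apply: leq_trans KZ; rewrite leq_mul2l; apply/orP; right.
  have : #|L :\: Q| <= #|L| by rewrite subset_leq_card // subsetDl.
  have : #|Z :|: F| <= #|Z| + #|F| by rewrite cardsU leq_subr.
  rewrite mulSn; lia.
have c1 : copies_in B H 1 F by apply: copies_in1 emb _.
apply: copies_inW (leqnn _) _ (copies_in_add _ c1 cg); last first.
  by rewrite disjoint_sym disjoints_subset setCS subsetUr.
by apply/subsetP=> x; rewrite !inE negb_or => /orP[/FZ//|/andP[]].
Qed.

(** * Induced subgraphs and heavy vertices *)

Lemma exists_subset_card (T : finType) (A : {set T}) (n : nat) :
  n <= #|A| -> exists X : {set T}, X \subset A /\ #|X| = n.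
Proof.
rewrite -bin_gt0 -cards_draws card_gt0 => /set0Pn[X].
by rewrite inE => /andP[XA /eqP Xn]; exists X.
Qed.

Lemma exists_superset_card (T : finType) (A C : {set T}) (n : nat) :
  A \subset C -> #|A| <= n <= #|C| ->
  exists X : {set T}, [/\ A \subset X, X \subset C & #|X| = n].
Proof.
move=> AC /andP[An nC].
have [|X [XA cX]] := @exists_subset_card T (C :\: A) (n - #|A|).
  by rewrite cardsD (setIidPr AC) leq_sub2r.
exists (A :|: X); split; first exact: subsetUl.
  by rewrite subUset AC (subset_trans XA) ?subsetDl.
have /eqP AX0 : A :&: X == set0.
  rewrite setI_eq0 disjoint_sym disjoints_subset (subset_trans XA) //.
  by rewrite setDE subsetIr.
by rewrite cardsU AX0 cards0 subn0 cX subnKC.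
Qed.

(** Vertices mapped outside [A] are rerouted to points of [A] not hit by the others; enough are free
    because [f] is injective and [#|V| <= #|A|]. *)
Lemma injection_into (V T : finType) (f : V -> T) (A : {set T}) :
  injective f -> #|V| <= #|A| ->
  exists g : {ffun V -> T}, [/\ injective g, forall v, g v \in A &
    forall v, f v \in A -> g v = f v].
Proof.
move=> injf VA; pose V' := [set v | f v \notin A].
pose A' := A :\: f @: ~: V'.
have VA' : #|V'| <= #|A'|.
  rewrite cardsD (setIidPr _); last first.
    by apply/subsetP=> _ /imsetP[v + ->]; rewrite !inE negbK.
  by rewrite card_imset //; have := cardsC V'; lia.
pose g := [ffun v => if f v \in A then f v
                     else nth (f v) (enum A') (index v (enum V'))].
have idx v : f v \notin A -> index v (enum V') < size (enum A').
  move=> fv; rewrite -cardE; apply: leq_trans VA'.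
  by rewrite cardE index_mem mem_enum inE.
have gA' v : f v \notin A -> g v \in A'.
  by move=> fv; rewrite ffunE (negbTE fv) -mem_enum mem_nth // idx.
have gA v : f v \in A -> g v = f v by move=> fv; rewrite ffunE fv.
exists g; split=> [v w|v|//]; last first.
  have [fv|/gA'] := boolP (f v \in A); first by rewrite gA.
  by rewrite inE => /andP[].
have mixed u x : f u \in A -> f x \notin A -> g u <> g x.
  move=> fu /gA' + gux; rewrite -gux gA // inE => /andP[/imsetP[]].
  by exists u => //; rewrite !inE negbK.
have [fv|fv] := boolP (f v \in A); have [fw|fw] := boolP (f w \in A).
- by rewrite !gA // => /injf.
- by move/mixed => /(_ fv fw).
- by move/esym/mixed => /(_ fw fv).
rewrite !ffunE (negbTE fv) (negbTE fw) (set_nth_default (f v)) ?idx // => /eqP.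
rewrite nth_uniq ?idx ?enum_uniq // => /eqP vw.
have v' : v \in enum V' by rewrite mem_enum inE.
have w' : w \in enum V' by rewrite mem_enum inE.
by rewrite -(nth_index v v') vw nth_index.
Qed.

(* [#|V| <= #|A|] leaves room to move the isolated vertices of [B] into [A];
   without it [ex] need not be monotone in [n]. *)
Lemma card_induced_le_ex (V T : finType) (r N : nat) (B : {set {set V}})
  (H : {set {set T}}) (A : {set T}) :
  is_rgraph r H -> #|V| <= #|A| <= N -> N <= #|T| -> ~ copies_in B H 1 A ->
  #|[set e in H | e \subset A]| <= ex r N B.
Proof.
move=> /forall_inP rH /andP[VA AN] NT noA.
have [|A1 [AA1 _ cA1]] := @exists_superset_card T A setT N (subsetT A).
  by rewrite AN cardsT.
pose psi (i : 'I_N) : T := enum_val (cast_ord (esym cA1) i).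
have inj : injective psi by move=> i j /enum_val_inj /cast_ord_inj.
have psi_onto x : x \in A1 -> exists i, psi i = x.
  move=> xA; exists (cast_ord cA1 (enum_rank_in xA x)).
  by rewrite /psi cast_ordK enum_rankK_in.
pose H' := [set e : {set 'I_N} | (psi @: e \in H) && (psi @: e \subset A)].
have -> : #|[set e in H | e \subset A]| = #|H'|.
  rewrite -(card_imset _ (imset_inj inj)); apply: eq_card => e; rewrite inE.
  apply/andP/imsetP => [[eH eA]|[e' + ->]]; last by rewrite inE => /andP[].
  have ee : e = psi @: (psi @^-1: e).
    apply/setP=> x; apply/idP/imsetP => [xe|[i + ->]]; last by rewrite inE.
    have [i ix] := psi_onto x (subsetP AA1 x (subsetP eA x xe)).
    by exists i; rewrite ?inE ix.
  by exists (psi @^-1: e); rewrite // inE -ee eH.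
apply: (@leq_bigmax_cond _ _ (fun H : {set {set 'I_N}} => #|H|)).
apply/andP; split.
  apply/forall_inP=> e; rewrite inE => /andP[/rH /eqP <- _].
  by rewrite card_imset.
apply/negP=> /copies_inP[f [fe _ _]].
have /andP[/injectiveP injf /forall_inP fB] := fe ord0.
(* Edges of [H'] land inside [A], so only isolated vertices of [B] are rerouted and the image of
   every edge is kept. *)
have [g [injg gA gE]] := injection_into (inj_comp inj injf) VA.
apply: noA; apply: (@copies_in1 _ _ _ _ g); last first.
  by apply/subsetP=> _ /imsetP[v _ ->].
apply/andP; split; first exact/injectiveP.
apply/forall_inP=> e /fB; rewrite inE => /andP[eH /subsetP eA].
suff -> : g @: e = psi @: (f ord0 @: e) by [].
rewrite -imset_comp; apply: eq_in_imset => v ve; apply: gE => /=.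
by apply/eA/imset_f/imset_f.
Qed.

(** Pascal's rule telescoped over [j] steps, each increment being at most the first one,
    ['C(n.-1, k)]. *)
Lemma bin_le_drop (n j k : nat) :
  'C(n, k.+1) <= 'C(n - j, k.+1) + j * 'C(n.-1, k).
Proof.
elim: j => [|j IH]; first by rewrite subn0 mul0n addn0.
apply: leq_trans IH _; rewrite subnS mulSn addnA leq_add2r.
case E: (n - j) => [|a] /=; first by rewrite leq_addr.
by rewrite binS leq_add2l leq_bin2l //; lia.
Qed.

(** The same telescoping, each increment being at least the last one. *)
Lemma bin_ge_drop (n j k : nat) : j <= n ->
  'C(n - j, k.+1) + j * 'C(n - j, k) <= 'C(n, k.+1).
Proof.
elim: j => [|j IH] jn; first by rewrite subn0 mul0n addn0.
apply: leq_trans (IH (ltnW jn)).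
have -> : n - j = (n - j.+1).+1 by lia.
rewrite binS mulSn -addnA leq_add2l leq_add2l leq_mul2l.
by rewrite leq_bin2l ?orbT.
Qed.

Definition heavy (T : finType) (k s : nat) (H : {set {set T}}) : {set T} :=
  [set x | 'C(#|T|.-1, k) <= 16 * s * degree H x].

(** Degree at least [1 - 1/K] times the maximum possible in a [k.+1]-graph, multiplied out by
    [K]. *)
Definition almost_full (T : finType) (k K : nat) (H : {set {set T}}) :
  {set T} := [set x | K * 'C(#|T|.-1, k) <= 'C(#|T|.-1, k) + K * degree H x].

(** Any [32 * sz 0 * s] heavy vertices have degree sum at least [2 * sz 0 * 'C(#|T|.-1, k)], which
    makes them rich. The additive reserve in the bound on [#|L|] keeps that many available before
    each of the [g] steps. *)
Lemma copies_from_heavy (V : finType) (k s K : nat) (sz : nat -> nat)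
  (W : 'I_k.+1 -> {set V}) (B : {set {set V}}) :
  r_partite sz W B -> (forall i, i < k.+1 -> 0 < sz i) -> 0 < s ->
  K = 64 * sz 0 * s ->
  exists n0, forall (T : finType) (H : {set {set T}}) g (L Z : {set T}),
    n0 <= #|T| -> is_rgraph k.+1 H -> L \subset heavy k s H ->
    sz 0 * g + 32 * sz 0 * s <= #|L| -> [disjoint L & Z] ->
    K * k * (#|Z| + #|L| + g * #|V|) <= #|T|.-1 -> copies_in B H g (~: Z).
Proof.
move=> partB sz0 s0 defK.
have [n0 Hn0] := greedy_copies (32 * sz 0 * s) K partB sz0.
exists n0 => T H g L Z nT rH LH cL LZ KZ.
pose P g (L : {set T}) :=
  L \subset heavy k s H /\ sz 0 * g + 32 * sz 0 * s <= #|L|.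
apply: (Hn0 T H P nT rH _ g L Z) => // {g L Z LH cL LZ KZ} g L [LH cL].
have [|Y [YL cY]] := @exists_subset_card T L (32 * sz 0 * s).
  exact: leq_trans (leq_addl _ _) cL.
exists Y; split=> //; first by rewrite cY.
  have : #|Y| * 'C(#|T|.-1, k) <= 16 * s * \sum_(x in Y) degree H x.
    rewrite -sum_nat_const big_distrr; apply: leq_sum => x /(subsetP YL).
    by move/(subsetP LH); rewrite inE.
  rewrite /rich cY defK; have := sz0 0 isT.
  move: (sz 0) 'C(_, _) (\sum_(x in _) _) => s1 D S s1_gt0 h.
  have -> : 64 * s1 * s * S = 4 * s1 * (16 * s * S) by lia.
  have h' : 4 * s1 * (32 * s1 * s * D) <= 4 * s1 * (16 * s * S).
    by rewrite leq_mul2l h orbT.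
  apply: leq_trans h'; rewrite mulnA leq_mul2r; apply/orP; right.
  have : s1 * s <= s1 * (s1 * s) by apply: leq_pmull.
  have : s1 * s > 0 by rewrite muln_gt0 s1_gt0.
  have -> : 64 * s1 * s * s1.-1 = 64 * (s1 * (s1 * s)) - 64 * (s1 * s) by nia.
  have -> : 4 * s1 * (32 * s1 * s) = 128 * (s1 * (s1 * s)) by lia.
  have -> : 32 * s1 * s = 32 * (s1 * s) by lia.
  lia.
move=> Q QY cQ; split; first exact: subset_trans (subsetDl _ _) LH.
rewrite cardsD (setIidPr (subset_trans QY YL)) cQ.
by move: cL; rewrite mulnS; lia.
Qed.

(** Here [L] is used up completely, in [sz 0]-sets with at most one vertex that is not almost full.
    The other [(sz 0).-1] vertices fall just short of richness, and one merely heavy vertex makes up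
    the difference. *)
Lemma copies_from_almost_full (V : finType) (k s K : nat) (sz : nat -> nat)
  (W : 'I_k.+1 -> {set V}) (B : {set {set V}}) :
  r_partite sz W B -> (forall i, i < k.+1 -> 0 < sz i) -> 1 < sz 0 ->
  0 < s -> K = 64 * sz 0 * s ->
  exists n0, forall (T : finType) (H : {set {set T}}) g (L Z : {set T}),
    n0 <= #|T| -> is_rgraph k.+1 H -> L \subset heavy k s H ->
    #|L| = sz 0 * g -> #|L :\: almost_full k K H| <= g -> [disjoint L & Z] ->
    K * k * (#|Z| + #|L| + g * #|V|) <= #|T|.-1 -> copies_in B H g (~: Z).
Proof.
move=> partB sz0 s1_gt1 s_gt0 defK.
have [n0 Hn0] := greedy_copies (sz 0) K partB sz0.
exists n0 => T H g L Z nT rH LH cL cN LZ KZ.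
set F := almost_full k K H in cN *.
pose P g (L : {set T}) :=
  [/\ L \subset heavy k s H, #|L| = sz 0 * g & #|L :\: F| <= g].
apply: (Hn0 T H P nT rH _ g L Z) => // {g L Z LH cL cN LZ KZ} g L [LH cL cN].
(* While exceptional vertices remain, [Y] takes exactly one, so their number decreases along with
   [g]. *)
have [Y [YL cY YN LYN]] : exists Y : {set T},
    [/\ Y \subset L, #|Y| = sz 0, #|Y :\: F| <= 1 & #|(L :\: Y) :\: F| <= g].
  have [N0|/set0Pn[y yN]] := eqVneq (L :\: F) set0.
    have [|Y [YL cY]] := @exists_subset_card T L (sz 0).
      by rewrite cL mulnS leq_addr.
    exists Y; split=> //.
      by apply: leq_trans (subset_leq_card (setSD _ YL)) _; rewrite N0 cards0.
    apply: leq_trans (subset_leq_card (setSD F (subsetDl L Y))) _.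
    by rewrite N0 cards0.
  (* At least [(sz 0).-1 * g.+1] vertices of [L] are almost full. *)
  have [|Y [YL cY]] := @exists_subset_card T (L :&: F) (sz 0).-1.
    have := cardsID F L; rewrite cL => h; nia.
  have yL : y \in L by move: yN; rewrite inE => /andP[].
  have yF : y \notin F by move: yN; rewrite inE => /andP[].
  have YF : Y \subset F by apply: subset_trans YL (subsetIr _ _).
  have yY : y \notin Y by apply: contra yF => /(subsetP YF).
  exists (y |: Y); split.
  - by rewrite subUset sub1set yL (subset_trans YL) // subsetIl.
  - by rewrite cardsU1 yY cY; lia.
  - rewrite -(cards1 y); apply/subset_leq_card/subsetP=> x.
    rewrite in_setD in_setU1 in_set1 => /andP[xF /orP[//|/(subsetP YF)]].
    by rewrite (negbTE xF).
  - have : #|(L :\: F) :\ y| <= g.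
      by have := cardsD1 y (L :\: F); rewrite yN; lia.
    apply: leq_trans; apply/subset_leq_card/subsetP=> x.
    rewrite !in_setD in_setU1 in_set1 negb_or.
    by case/and3P=> -> /andP[-> _] ->.
exists Y; split=> //; first by rewrite cY.
  rewrite /rich cY defK; set D := 'C(_, _).
  have h1 x : x \in Y :\: F -> 4 * sz 0 * D <= K * degree H x.
    rewrite inE => /andP[_ /(subsetP YL)/(subsetP LH)]; rewrite inE -/D defK.
    have -> : 64 * sz 0 * s = 4 * sz 0 * (16 * s) by lia.
    by move=> h; rewrite -[X in _ <= X]mulnA leq_mul2l h orbT.
  have h2 x : x \in Y :&: F -> K * D <= D + K * degree H x.
    by rewrite inE => /andP[_]; rewrite inE.
  rewrite -defK.
  have sumYF : #|Y :&: F| * (K * D) <=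
      #|Y :&: F| * D + K * \sum_(x in Y :&: F) degree H x.
    rewrite -!sum_nat_const big_distrr -big_split; exact: leq_sum.
  have sumYN : #|Y :\: F| * (4 * sz 0 * D) <=
      K * \sum_(x in Y :\: F) degree H x.
    by rewrite -sum_nat_const big_distrr; apply: leq_sum.
  have sumY : \sum_(x in Y) degree H x = \sum_(x in Y :&: F) degree H x +
      \sum_(x in Y :\: F) degree H x by rewrite (big_setID F).
  have cYF := cardsID F Y; rewrite cY in cYF.
  have Kge : 2 * sz 0 + 1 <= K by rewrite defK; nia.
  rewrite sumY mulnDr; move: Kge s1_gt1 sumYF sumYN cYF.
  move: (K * \sum_(x in Y :&: F) _) (K * \sum_(x in Y :\: F) _) => SF SN.
  case: #|Y :\: F| YN => [|[|//]] _ Kge s1_gt1 sumYF sumYN cYF.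
    have defY : #|Y :&: F| = sz 0 by lia.
    rewrite defY in sumYF; nia.
  have defY : #|Y :&: F| = (sz 0).-1 by lia.
  rewrite defY in sumYF; nia.
move=> Q QY cQ; have -> : Q = Y by apply/eqP; rewrite eqEcard QY cQ cY /=.
split=> //; first exact: subset_trans (subsetDl _ _) LH.
by rewrite cardsD (setIidPr YL) cY cL mulnS; lia.
Qed.

(** * The extremal bound *)

Lemma card_split_meeting (T : finType) (H : {set {set T}}) (L X : {set T}) :
  #|H| <= #|[set e in H | ~~ [disjoint e & L]]| + \sum_(x in X) degree H x
    + #|[set e in H | e \subset ~: (L :|: X)]|.
Proof.
apply: (@leq_trans (#|[set e in H | ~~ [disjoint e & L]]| +
  #|[set e in H | ~~ [disjoint e & X]]|
    + #|[set e in H | e \subset ~: (L :|: X)]|)); last first.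
  by rewrite leq_add2r leq_add2l card_meeting_le.
set E1 := [set e in H | _]; set E2 := [set e in H | _].
set E3 := [set e in H | _].
have sub : H \subset E1 :|: E2 :|: E3.
  apply/subsetP=> e eH; rewrite !inE eH /= setCU subsetI -!disjoints_subset.
  by case: [disjoint e & L]; case: [disjoint e & X].
apply: leq_trans (subset_leq_card sub) _.
rewrite cardsU (leq_trans (leq_subr _ _)) // leq_add2r.
by rewrite cardsU leq_subr.
Qed.

Lemma card_meeting_le_bin (T : finType) (r : nat) (H : {set {set T}})
  (L : {set T}) : is_rgraph r H ->
  #|[set e in H | ~~ [disjoint e & L]]| <= 'C(#|T|, r) - 'C(#|T| - #|L|, r).
Proof.
move=> /forall_inP rH.
have -> : #|T| - #|L| = #|~: L| by rewrite [RHS]cardsCs setCK.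
rewrite -cardsT -!cards_draws.
set A := [set A : {set T} | _]; set A' := [set A : {set T} | _].
have AA : A' \subset A.
  by apply/subsetP=> e; rewrite !inE => /andP[_ ->]; rewrite subsetT.
have -> : #|A| - #|A'| = #|A :\: A'| by rewrite cardsD (setIidPr AA).
apply/subset_leq_card/subsetP=> e; rewrite !inE => /andP[eH eL].
by rewrite rH // andbT -disjoints_subset eL subsetT.
Qed.

Lemma exists_max_copies (V T : finType) (B : {set {set V}})
  (H : {set {set T}}) (U : {set T}) (t : nat) :
  ~ copies_in B H t.+1 U ->
  exists t', [/\ t' <= t, copies_in B H t' U & ~ copies_in B H t'.+1 U].
Proof.
elim: t => [|t IH] no; first by exists 0; split=> //; apply: copies_in0.
case: (classic (copies_in B H t.+1 U)) => [yes|/IH[t' [tt' ? ?]]].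
  by exists t.+1.
by exists t'; split=> //; apply: leqW.
Qed.

(** Put [p = s1 * s] and [l0 = s1 * t.+1 - 1]. Comparing the bounds on [h] and dividing by [D] gives
    [64 p l0 + w <= 64 p l + 4 p t' + 9 t / 40], where [9/40 = 1/8 + 1/10]. As [s1 >= 2], the bound
    on [l + s1 * t'] makes [64 p (l - l0)] at most [2048 p^2 - 128 p t'], and [2048 p^2 <= t / 40].
    The fractions of [t] add up to [1/4]. *)
Lemma few_exceptions_arith (s1 s t t' l w D x y h : nat) :
  1 < s1 -> 2 * s1 <= s -> 0 < D -> 8 * x <= t * D -> 10 * y <= t * D ->
  64 * s1 * s * (s1 * t.+1 - 1) * D <= 64 * s1 * s * h + x ->
  64 * s1 * s * h + w * D <= 64 * s1 * s * l * D + 4 * s1 * s * t' * D + y ->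
  l + s1 * t' < s1 * t.+1 + 32 * s1 * s -> 32 * 2560 * (s1 * s) ^ 2 <= t ->
  4 * (w + t') <= t.
Proof.
move=> s1_gt1 ss D0 hx hy h1 h2 hl ht.
set p := s1 * s in ht *; have pE : s1 * s = p by [].
have eK : 64 * s1 * s = 64 * p by lia.
have e4 : 4 * s1 * s = 4 * p by lia.
have e32 : 32 * s1 * s = 32 * p by lia.
rewrite eK e4 in h1 h2; rewrite e32 in hl.
have p8 : 8 <= p by rewrite /p; nia.
set l0 := s1 * t.+1 - 1 in h1; have hl0 : l + s1 * t' <= l0 + 32 * p by lia.
clearbody p l0.
have h3 : (2560 * (p * l0) + 40 * w) * D
    <= (2560 * (p * l) + 160 * (p * t') + 9 * t) * D.
  have -> : (2560 * (p * l0) + 40 * w) * D =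
    40 * (64 * p * l0 * D + w * D) by lia.
  have -> : (2560 * (p * l) + 160 * (p * t') + 9 * t) * D =
    40 * (64 * p * l * D + 4 * p * t' * D) + 5 * (t * D) + 4 * (t * D) by lia.
  lia.
rewrite leq_pmul2r // in h3.
have h4 : p * l + p * (s1 * t') <= p * l0 + 32 * (p * p).
  rewrite (mulnCA 32) -!mulnDr leq_mul2l hl0 orbT //.
have h5 : 2 * (p * t') <= p * (s1 * t').
  by rewrite mulnCA leq_mul2l leq_mul2r s1_gt1 !orbT.
have h6 : 8 * t' <= p * t' by rewrite leq_mul2r p8 orbT.
have h7 : 32 * 2560 * (p * p) <= t by move: ht; rewrite expnS expn1.
lia.
Qed.

(** The whole combinatorial argument, with the range of [t] replaced by the three inequalities
    between natural numbers that it uses. *)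
Lemma card_le_of_no_copies (V : finType) (k : nat) (sz : nat -> nat)
  (W : 'I_k.+1 -> {set V}) (B : {set {set V}}) (s : nat) :
  0 < k -> 1 < sz 0 -> (forall i, i < k.+1 -> sz 0 <= sz i) ->
  r_partite sz W B -> s = \sum_(i < k.+1) sz i ->
  exists n0, forall (T : finType) (H : {set {set T}}) (t : nat),
    n0 <= #|T| -> is_rgraph k.+1 H ->
    640 * sz 0 * s * ex k.+1 #|T| B <= t * 'C(#|T|.-1, k) ->
    32 * 2560 * (sz 0 * s) ^ 2 <= t -> 1024 * sz 0 * s ^ 3 * k * t <= #|T| ->
    ~ copies_in B H t.+1 [set: T] ->
    #|H| <= 'C(#|T|, k.+1) - 'C(#|T| - (sz 0 * t.+1 - 1), k.+1)
            + ex k.+1 (#|T| - (sz 0 * t.+1 - 1)) B.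
Proof.
move=> k0 s1_gt1 szmin partB defs.
have sz0 i : i < k.+1 -> 0 < sz i by move/szmin; lia.
have ss : 2 * sz 0 <= s.
  rewrite defs big_ord_recl.
  have : \sum_(i < k) sz 0 <= \sum_(i < k) sz (lift ord0 i).
    by apply: leq_sum => i _; apply: szmin.
  by rewrite sum_nat_const card_ord /= => h; nia.
have s_gt0 : 0 < s by lia.
have Vs : #|V| <= s.
  have [cW [_ [covW _]]] := partB.
  have -> : #|V| = #|\bigcup_i W i|.
    rewrite -cardsT; apply: eq_card => v; rewrite inE; symmetry.
    by apply/bigcupP; have [i vi] := covW v; exists i.
  apply: leq_trans (card_bigcup_le _ _) _.
  by rewrite defs; apply: leq_sum => i _; rewrite cW.
have [K defK] : exists K, K = 64 * sz 0 * s by exists (64 * sz 0 * s).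
have [n1 Hheavy] := copies_from_heavy partB sz0 s_gt0 defK.
have [n2 Hfull] := copies_from_almost_full partB sz0 s1_gt1 s_gt0 defK.
exists (n1 + n2 + k + 2) => T H t nT rH hE ht hn noH.
rewrite leqNgt; apply/negP=> bigH.
set s1 := sz 0 in s1_gt1 szmin ss defK Hheavy Hfull hE ht hn bigH *.
set n := #|T| in Hheavy Hfull nT hE hn bigH *.
set D := 'C(n.-1, k) in hE *.
set l0 := s1 * t.+1 - 1 in bigH.
have D0 : 0 < D by rewrite bin_gt0; lia.
have s1s_ge8 : 8 <= s1 * s by nia.
have t_big : 256 * 2560 * (s1 * s) <= t.
  by apply: leq_trans ht; rewrite expnS expn1; nia.
have n_big : 1024 * (s1 * s) * (s * s) * (k * t) <= n.
  by apply: leq_trans hn; rewrite !expnS expn0; lia.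
have [n_big1 n_big2] : K * k * (4 * (t * s)) <= n.-1 /\ l0 + 4 * (t * s) <= n.
  have kt0 : 0 < k * t by rewrite muln_gt0 k0; lia.
  have e1 : K * k * (4 * (t * s)) = 256 * (s1 * s) * s * (k * t).
    by rewrite defK; lia.
  have e2 : 256 * (s1 * s) * s * (k * t) <= 256 * (s1 * s) * (s * s) * (k * t).
    by rewrite leq_mul2r leq_mul2l leq_pmull ?orbT.
  have e3 : 0 < (s1 * s) * (s * s) * (k * t) by rewrite !muln_gt0; lia.
  have e4 : t * s <= (s1 * s) * (s * s) * (k * t).
    have -> : s1 * s * (s * s) * (k * t) = (t * s) * (s1 * s * s * k) by lia.
    by rewrite leq_pmulr // !muln_gt0; lia.
  have e5 : s1 * t.+1 <= t * s by rewrite mulnS; nia.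
  by split; lia.
(* Passing from [D] to ['C(n - l0, k)] loses at most [l0 * c2], which the upper bound on [t] makes
   small against [D]. *)
set c2 := 'C(n.-1.-1, k.-1).
have c2E : n.-1 * c2 = k * D by rewrite mul_bin_diag prednK.
have l0_le : l0 <= 2 * s1 * t by rewrite /l0; nia.
have l0_ge : s1 * t <= l0 by rewrite /l0; nia.
have l0_gt0 : 0 < l0 by rewrite /l0; nia.
have l0c2 : 256 * (s * (s * s)) * (l0 * c2) <= D.
  rewrite -(leq_pmul2l k0) -c2E.
  have -> : k * (256 * (s * (s * s)) * (l0 * c2)) =
    (256 * (s * (s * s)) * (k * l0)) * c2 by lia.
  rewrite leq_mul2r; apply/orP; right.
  have : 256 * (s * (s * s)) * (k * l0) <=
      256 * (s * (s * s)) * (k * (2 * s1 * t)).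
    by rewrite !leq_mul2l l0_le !orbT.
  have : 0 < (s * (s * s)) * (k * (s1 * t)) by rewrite !muln_gt0; lia.
  lia.
have small_x : 8 * (K * (l0 * (l0 * c2))) <= t * D.
  have e1 : 4 * (s1 * s1) <= s * s by nia.
  have e2 : 8 * (K * (l0 * (l0 * c2))) <= 8 * (K * (2 * s1 * t * (l0 * c2))).
    by rewrite !leq_mul2l !leq_mul2r l0_le !orbT.
  apply: leq_trans e2 _.
  apply: leq_trans (_ : t * (256 * (s * (s * s)) * (l0 * c2)) <= _); last first.
    by rewrite leq_mul2l l0c2 orbT.
  have -> : 8 * (K * (2 * s1 * t * (l0 * c2))) =
    4 * (s1 * s1) * (256 * s * t * (l0 * c2)) by rewrite defK; lia.
  apply: leq_trans (_ : s * s * (256 * s * t * (l0 * c2)) <= _).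
    by rewrite leq_mul2r e1 orbT.
  by lia.
have half_x : 2 * (l0 * c2) <= D.
  apply: leq_trans l0c2; rewrite leq_mul2r; apply/orP; right.
  have : 0 < s * (s * s) by rewrite !muln_gt0 s_gt0.
  lia.
(* Starting from [n.-1], only [l0.-1] steps are needed to reach [n - l0]. *)
have binl0 : D <= 'C(n - l0, k) + l0 * c2.
  have := bin_le_drop n.-1 l0.-1 k.-1; rewrite prednK // -/D -/c2.
  have -> : n.-1 - l0.-1 = n - l0 by lia.
  move/leq_trans; apply; rewrite leq_add2l leq_mul2r leq_pred orbT //.
have l0n : l0 <= n by lia.
have H_large : K * l0 * D <= K * #|H| + K * (l0 * (l0 * c2)).
  rewrite -mulnA -mulnDr leq_mul2l; apply/orP; right.
  have := bin_ge_drop k l0n; have : l0 * D <= l0 * ('C(n - l0, k) + l0 * c2).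
    by rewrite leq_mul2l binl0 orbT.
  by rewrite mulnDr; lia.
pose L := heavy k s H.
have degL x : x \notin L -> 16 * s * degree H x <= D.
  by rewrite inE -ltnNge => /ltnW.
have sum_light (X : {set T}) :
    X \subset ~: L -> 16 * s * \sum_(x in X) degree H x <= #|X| * D.
  move=> XL; rewrite -sum_nat_const big_distrr; apply: leq_sum => x xX.
  by apply: degL; move/subsetP: XL => /(_ x xX); rewrite inE.
have [t' [tt' cop noL]] : exists t', [/\ t' <= t, copies_in B H t' (~: L) &
    ~ copies_in B H t'.+1 (~: L)].
  apply: exists_max_copies => h; apply: noH.
  by apply: copies_inW h; rewrite ?subsetT.
have [U [UL cU copU]] := copies_in_support cop.
have {}cU : #|U| <= t' * s by apply: leq_trans cU _; rewrite leq_mul2l Vs orbT.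
have no1 : ~ copies_in B H 1 (~: (L :|: U)).
  move=> c1; apply: noL; rewrite -addn1.
  apply: copies_inW (leqnn _) _ (copies_in_add _ copU c1).
    by rewrite subUset UL setCS subsetUl.
  by rewrite disjoint_sym disjoints_subset setCS subsetUr.
have LU (L1 : {set T}) : L1 \subset L -> [disjoint L1 & U].
  move=> L1L; rewrite disjoint_sym disjoints_subset; apply: subset_trans UL _.
  by rewrite setCS.
(* Such copies together with the [t'] inside [U] would be [t.+1] disjoint ones. Both bounds on
   [#|L|] below contradict this. *)
have noL1 : ~ copies_in B H (t.+1 - t') (~: U).
  move=> cg; apply: noH; have -> : t.+1 = t' + (t.+1 - t') by lia.
  apply: copies_inW (leqnn _) (subsetT _) (copies_in_add _ copU cg).
  by rewrite disjoints_subset setCK.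
set g := t.+1 - t' in noL1.
have room (L1 : {set T}) : #|L1| <= s1 * g + 32 * s1 * s ->
    K * k * (#|U| + #|L1| + g * #|V|) <= n.-1.
  move=> cL1; apply: leq_trans n_big1; rewrite leq_mul2l; apply/orP; right.
  have : #|U| <= t * s by apply: leq_trans cU _; rewrite leq_mul2r tt' orbT.
  have gt : g <= t.+1 by rewrite leq_subr.
  have : g * #|V| <= t.+1 * s by rewrite leq_mul.
  have : s1 * g <= s1 * t.+1 by rewrite leq_mul2l gt orbT.
  have : s1 * t.+1 <= t * s by rewrite mulnS; nia.
  have : 64 * s1 * s <= t * s by rewrite leq_mul2r; apply/orP; right; nia.
  have : 64 * s <= t * s by rewrite leq_mul2r; apply/orP; right; nia.
  lia.
have few_heavy : #|L| + s1 * t' < s1 * t.+1 + 32 * s1 * s.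
  rewrite ltnNge; apply/negP=> manyL; apply: noL1.
  have [|L1 [L1L cL1]] := @exists_subset_card T L (s1 * g + 32 * s1 * s).
    have : s1 * t' <= s1 * t.+1 by rewrite leq_mul2l leqW ?orbT.
    by rewrite /g mulnBr; lia.
  apply: (Hheavy T H g L1 U) => //; first by lia.
  - by rewrite cL1.
  - exact: LU.
  - by apply: room; rewrite cL1.
have ts_big : 64 * s1 * s <= t * s.
  by rewrite leq_mul2r; apply/orP; right; nia.
have s_ts : s <= t * s by rewrite leq_pmull //; lia.
have card_compl (X : {set T}) : [disjoint L & X] ->
    #|~: (L :|: X)| = n - #|L| - #|X|.
  move=> LX; rewrite cardsCs setCK cardsU (disjoint_setI0 LX) cards0 subn0.
  by rewrite subnDA.
have U_ts : #|U| <= t * s by apply: leq_trans cU _; rewrite leq_mul2r tt' orbT.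
pose w := #|L :\: almost_full k K H|.
(* Each of the [w] exceptional vertices falls short of degree [D] by at least [D / K]. *)
have sumL : K * \sum_(x in L) degree H x + w * D <= K * #|L| * D.
  rewrite (big_setID (almost_full k K H)) /=.
  rewrite -(cardsID (almost_full k K H) L) -/w.
  have h1 : \sum_(x in L :&: almost_full k K H) degree H x <=
      #|L :&: almost_full k K H| * D.
    by rewrite -sum_nat_const; apply: leq_sum => x _; apply: (degree_le x rH).
  have h2 : K * \sum_(x in L :\: almost_full k K H) degree H x + w * D <=
      w * (K * D).
    rewrite -!sum_nat_const big_distrr -big_split /=; apply: leq_sum => x.
    by rewrite inE => /andP[]; rewrite inE -ltnNge addnC => /ltnW.
  rewrite !mulnDr mulnDl -addnA; apply: leq_add.
    by rewrite -mulnA leq_mul2l h1 orbT.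
  by apply: leq_trans h2 _; rewrite mulnCA mulnA.
(* Edges avoiding [L] and [U] span no copy of [B], and the at most [t' * s] light vertices of [U]
   account for at most [t' * D / 16] edges; [K / 16 = 4 * s1 * s]. *)
have light_bound : K * #|H| + w * D <=
    K * #|L| * D + 4 * s1 * s * t' * D + K * ex k.+1 n B.
  have h1 := card_split_meeting H L U.
  have h2 : #|[set e in H | e \subset ~: (L :|: U)]| <= ex k.+1 n B.
    by apply: card_induced_le_ex => //; rewrite card_compl ?LU //; lia.
  have h3 := card_meeting_le H L.
  have h4 : 16 * \sum_(x in U) degree H x <= t' * D.
    rewrite -(leq_pmul2l s_gt0).
    apply: leq_trans (leq_trans (sum_light U UL) _).
      by lia.
    by rewrite mulnCA mulnA leq_mul2r cU orbT.
  have h5 : K * \sum_(x in U) degree H x <= 4 * s1 * s * t' * D.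
    rewrite defK.
    have -> : 64 * s1 * s * \sum_(x in U) degree H x =
      4 * s1 * s * (16 * \sum_(x in U) degree H x) by lia.
    by rewrite -[4 * s1 * s * t' * D]mulnA leq_mul2l h4 orbT.
  have h6 : #|H| <= \sum_(x in L) degree H x + \sum_(x in U) degree H x +
    ex k.+1 n B by lia.
  have : K * #|H| <= K * \sum_(x in L) degree H x +
      K * \sum_(x in U) degree H x + K * ex k.+1 n B.
    by rewrite -!mulnDr leq_mul2l h6 orbT.
  lia.
have few : 4 * (w + t') <= t.
  apply: (@few_exceptions_arith s1 s t t' #|L| w D (K * (l0 * (l0 * c2)))
    (K * ex k.+1 n B) #|H|) => //; rewrite -?defK //.
  by rewrite defK; lia.
(* Since [4 * (w + t') <= t], the exceptions number at most [g], so [s1 * g] vertices of [L] already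
   yield [g] copies, without the reserve. *)
have L_le : #|L| + s1 * t' <= l0.
  rewrite leqNgt; apply/negP=> manyL; apply: noL1.
  have gE : s1 * g = s1 * t.+1 - s1 * t' by rewrite /g mulnBr.
  have [|L1 [L1L cL1]] := @exists_subset_card T L (s1 * g).
    by rewrite gE; rewrite /l0 in manyL; lia.
  apply: (Hfull T H g L1 U) => //; first by lia.
  - apply: leq_trans (subset_leq_card (setSD _ L1L)) _.
    by rewrite -/w /g; lia.
  - exact: LU.
  - by apply: room; rewrite cL1 leq_addr.
have [m Lm] : exists m, #|L| + m = l0.
  by exists (l0 - #|L|); apply: subnKC; apply: leq_trans L_le; apply: leq_addr.
have s1t'_m : s1 * t' <= m by rewrite -(leq_add2l #|L|) Lm.
have cLc : #|~: L| = n - #|L| by rewrite cardsCs setCK.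
have Um : #|U| <= m * s.
  apply: leq_trans cU _; rewrite leq_mul2r; apply/orP; right.
  by apply: leq_trans s1t'_m; rewrite leq_pmull // ltnW.
(* [X] must contain [U] to leave no copy of [B], and have at least [m] vertices to leave at most
   [n - l0]; both [m] and [#|U|] are at most [m * s]. *)
have [|X [UX XL cX]] := @exists_superset_card T U (~: L) (maxn m #|U|) UL.
  rewrite leq_maxr cLc geq_max; apply/andP; move: Lm U_ts n_big2; clear.
  by split; lia.
have LX : [disjoint L & X] by rewrite disjoint_sym disjoints_subset.
have mX : m <= #|X| by rewrite cX leq_maxl.
have roomX : #|L| + #|X| + s <= n.
  have : #|X| <= m + t * s.
    by rewrite cX geq_max leq_addr (leq_trans U_ts) ?leq_addl.
  by move: Lm s_ts n_big2; clear; lia.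
have cXm : #|X| <= m * s by rewrite cX geq_max Um andbT leq_pmulr.
have sumX : 16 * \sum_(x in X) degree H x <= m * D.
  rewrite -(leq_pmul2l s_gt0); apply: leq_trans (leq_trans (sum_light X XL) _).
    by lia.
  by rewrite mulnCA mulnA leq_mul2r cXm orbT.
have exX : #|[set e in H | e \subset ~: (L :|: X)]| <= ex k.+1 (n - l0) B.
  apply: card_induced_le_ex; rewrite ?card_compl //.
  - by apply/andP; move: Vs mX Lm roomX; clear; split; lia.
  - by rewrite leq_subr.
  - by move=> c1; apply: no1; apply: copies_inW c1; rewrite // setCS setUS.
have h1 := card_split_meeting H L X.
have h2 := card_meeting_le_bin L rH.
have h3 : 'C(n - l0, k.+1) + m * 'C(n - l0, k) <= 'C(n - #|L|, k.+1).
  rewrite -Lm subnDA; apply: bin_ge_drop.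
  by move: mX roomX; clear; lia.
have h4 : 'C(n - #|L|, k.+1) <= 'C(n, k.+1) by rewrite leq_bin2l ?leq_subr.
have h5 : m * D <= m * 'C(n - l0, k) + m * (l0 * c2).
  by rewrite -mulnDr leq_mul2l binl0 orbT.
have h6 : 2 * (m * (l0 * c2)) <= m * D by rewrite mulnCA leq_mul2l half_x orbT.
(* The gain is at least [m * D / 2], the loss at most [m * D / 16]. For [m = 0] both bounds vanish,
   and the strict inequality [bigH] still gives the contradiction. *)
rewrite -/n in h2; move: bigH h1 h2 h3 h4 h5 h6 sumX exX; clear; lia.
Qed.

(** * From the real range of [t] to natural numbers *)

Lemma INR_muln (a b : nat) : INR (a * b)%N = (INR a * INR b)%R.
Proof. by rewrite -multE mult_INR. Qed.

(** Each summand of the lower bound yields one conclusion. From [2 < exp 1] come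
    [640 <= 320 * exp 1] and a square of at least [409600], more than the required [32 * 2560]. *)
Lemma range_lower_nat (s1 s f t E D : nat) :
  0 < D -> 0 < s -> 0 < f ->
  (320 * exp 1 * INR s1 * INR s *
     (INR E / INR D + 320 * exp 1 * INR s1 * INR s ^ 2 * INR f) <= INR t)%R ->
  640 * s1 * s * E <= t * D /\ 32 * 2560 * (s1 * s) ^ 2 <= t.
Proof.
move=> /ltP/lt_INR/= D0 /leP/le_INR/= s_ge1 /leP/le_INR/= f_ge1 h.
have e2 : (2 < exp 1)%R by have := exp_ineq1 1; lra.
have [E0 s10] := (pos_INR E, pos_INR s1).
have a0 : (0 <= INR s1 * INR s)%R by apply: Rmult_le_pos; lra.
have x0 : (0 <= INR E / INR D)%R by apply: Rle_mult_inv_pos.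
set a := (INR s1 * INR s)%R in a0.
set x := (INR E / INR D)%R in h x0.
set c := (INR s * INR f)%R.
have c1 : (1 <= c)%R by rewrite /c; nra.
have h' : (320 * exp 1 * (a * x) +
    102400 * (exp 1 * exp 1) * (a * a * c) <= INR t)%R.
  by apply: Rle_trans h; apply: Req_le; rewrite /a /c; ring.
have ax0 : (0 <= a * x)%R by apply: Rmult_le_pos.
have aa0 : (0 <= a * a)%R by apply: Rmult_le_pos.
have aac : (a * a <= a * a * c)%R by nra.
have ee : (4 <= exp 1 * exp 1)%R by nra.
have u1 : (640 * (a * x) <= 320 * exp 1 * (a * x))%R by nra.
have u2 : (409600 * (a * a) <= 102400 * (exp 1 * exp 1) * (a * a * c))%R.
  apply: (Rle_trans _ (102400 * (exp 1 * exp 1) * (a * a))); nra.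
split; apply/leP/INR_le.
  rewrite !INR_muln (_ : INR 640 = 640%R); last by rewrite INR_IZR_INZ.
  have -> : (640 * INR s1 * INR s * INR E = 640 * (a * x) * INR D)%R.
    by rewrite /a /x; field; lra.
  by apply: Rmult_le_compat_r; lra.
have [c' -> c'R] : exists2 c', 32 * 2560 = c' & INR c' = 81920%R.
  by exists (32 * 2560); rewrite // INR_muln !INR_IZR_INZ -mult_IZR.
rewrite expnS expn1 !INR_muln -/a c'R; lra.
Qed.

(** Clearing the denominator leaves [1024 <= 512 * exp 1] and [k <= f], where [f] stands for the
    factorial. *)
Lemma range_upper_nat (s1 s f k t n : nat) :
  0 < s1 -> 0 < s -> 0 < f -> k <= f ->
  (INR t <= INR n / (512 * exp 1 * INR s1 * INR s ^ 3 * INR f))%R ->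
  1024 * s1 * s ^ 3 * k * t <= n.
Proof.
move=> /ltP/lt_INR/= s1_gt0 /ltP/lt_INR/= s_gt0 /ltP/lt_INR/= f_gt0.
move=> /leP/le_INR kf h; have e2 : (2 < exp 1)%R by have := exp_ineq1 1; lra.
set b := (INR s1 * INR s ^ 3)%R.
have b0 : (0 < b)%R by apply: Rmult_lt_0_compat => //; apply: pow_lt.
have t0 := pos_INR t.
have c0 : (0 < 512 * exp 1 * INR s1 * INR s ^ 3 * INR f)%R.
  have -> : (512 * exp 1 * INR s1 * INR s ^ 3 * INR f =
    512 * exp 1 * b * INR f)%R by rewrite /b; ring.
  by repeat apply: Rmult_lt_0_compat => //; lra.
have {}h : (INR t * (512 * exp 1 * INR s1 * INR s ^ 3 * INR f) <= INR n)%R.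
  have := Rmult_le_compat_r _ _ _ (Rlt_le _ _ c0) h.
  have cancel_div (u v : R) : (0 < v -> u / v * v = u)%R.
    by move=> v0; field; lra.
  by rewrite cancel_div.
apply/leP/INR_le; apply: Rle_trans h.
rewrite !expnS expn0 !INR_muln (_ : INR 1024 = 1024%R); last first.
  by rewrite INR_IZR_INZ.
have -> : (1024 * INR s1 * (INR s * (INR s * (INR s * INR 1))) * INR k * INR t =
  INR t * (b * (1024 * INR k)))%R by rewrite /b /=; ring.
have -> : (INR t * (512 * exp 1 * INR s1 * INR s ^ 3 * INR f) =
  INR t * (b * (512 * exp 1 * INR f)))%R by rewrite /b; ring.
apply: Rmult_le_compat_l => //; apply: Rmult_le_compat_l; first lra.
have k0 := pos_INR k; nra.
Qed.

Theorem theorem1p11 (r : nat) (sz : nat -> nat) (V : finType)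
  (W : 'I_r -> {set V}) (B : {set {set V}}) :
  (2 <= r)%N ->
  (2 <= sz 0%N)%N ->
  (forall i j, (i <= j)%N -> (j < r)%N -> (sz i <= sz j)%N) ->
  r_partite sz W B ->
  let s1 := sz 0%N in
  let s := (\sum_(i < r) sz i)%N in
  exists n0 : nat, forall n : nat, (n0 <= n)%N ->
  forall t : nat,
    (320 * exp 1 * INR s1 * INR s *
       (INR (ex r n B) / INR 'C(n.-1, r.-1)
        + 320 * exp 1 * INR s1 * INR s ^ 2 * INR (r`!)) <= INR t)%R ->
    (INR t <= INR n / (512 * exp 1 * INR s1 * INR s ^ 3 * INR (r`!)))%R ->
    (ex_copies r n t.+1 B <=
       'C(n, r) - 'C(n - s1 * t.+1 + 1, r) + ex r (n - s1 * t.+1 + 1) B)%N.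
Proof.
case: r W => [//|k] W k_ge1 s1_ge2 mono partB s1 s.
have szmin i : i < k.+1 -> sz 0 <= sz i by move=> ik; apply: mono.
have s1s : s1 <= s by rewrite /s big_ord_recl leq_addr.
have [n0 Hn0] := card_le_of_no_copies k_ge1 s1_ge2 szmin partB (erefl s).
exists (n0 + k + 2) => n n_ge t lower upper.
have D0 : 0 < 'C(n.-1, k) by rewrite bin_gt0; lia.
have s_gt0 : 0 < s by apply: leq_trans s1s; apply: ltnW.
have kf : k <= (k.+1)`!.
  by rewrite factS (leq_trans (leqnSn k)) // leq_pmulr // fact_gt0.
have [h1 h2] := range_lower_nat D0 s_gt0 (fact_gt0 k.+1) lower.
have h3 := range_upper_nat (ltnW s1_ge2) s_gt0 (fact_gt0 k.+1) kf upper.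
(* Needed for [n - s1 * t.+1 + 1] to equal [n - (s1 * t.+1 - 1)], as subtraction is truncated. The
   lower bound on [t] gives [0 < t], hence [s1 * t.+1 <= 2 * s1 * t]. *)
have s1t : 0 < s1 * t.+1 <= n.
  rewrite muln_gt0 ltnW //=; apply: leq_trans h3.
  have t0 : 0 < t.
    have s1_gt0 : 0 < s1 by apply: ltnW.
    by apply: leq_trans h2; rewrite expnS expn1 !muln_gt0 s_gt0 s1_gt0.
  have : 0 < s ^ 3 * k by rewrite muln_gt0 expn_gt0 s_gt0 (k_ge1 : 0 < k).
  have -> : 1024 * s1 * s ^ 3 * k * t = (s1 * t) * (1024 * (s ^ 3 * k)) by lia.
  move=> p0; apply: (@leq_trans (s1 * t * 2)); last by rewrite leq_mul2l; lia.
  by rewrite mulnS; nia.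
have -> : n - s1 * t.+1 + 1 = n - (s1 * t.+1 - 1) by lia.
apply/bigmax_leqP => H /andP[rH /negP noH].
have := Hn0 'I_n H t; rewrite card_ord; apply=> //; first by lia.
by move/copies_inP.
Qed.
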